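(* Let $F$ be a field which is not of characteristic $2$, and let $V$ be a three-dimensional vector space over $F$ spanned by $\{i,j,k\}$. Suppose that the set $\{i,j,k\}$ is orthogonal with respect to a symmetric bilinear form $B$ on $V$. (a) Suppose $B(i,i)=B(j,j)=B(k,k)=-2$. Then the Kingdon algebra $K(V,B)$ is isomorphic to the octonion algebra $\mathbb{O}$ over $F$. (b) Suppose $B(i,i)=B(j,j)=-2$ and $B(k,k)=2$. Then the Kingdon algebra $K(V,B)$ is isomorphic to the split octonion algebra $\widetilde{\mathbb{O}}$ over $F$.
   Context: Algebras over $F$ are unital but not necessarily associative, and isomorphisms are isomorphisms of $F$-algebras. An algebra is alternative if $x(xy)=(xx)y$ and $y(xx)=(yx)x$ for all elements $x,y$. For a vector space $V$ over $F$, $\mathrm{Alt}[V]$ denotes the free (unital) alternative $F$-algebra over $V$: it is alternative, contains $V$ as a subspace and $F=F1$, and each linear map from $V$ to an alternative $F$-algebra $A$ extends uniquely to an $F$-algebra homomorphism $\mathrm{Alt}[V]\to A$. For a finite-dimensional $V$ with a symmetric bilinear form $B$, the Kingdon algebra is $K(V,B)=\mathrm{Alt}[V]/I_B$, where $I_B$ is the two-sided ideal generated by all elements $uv+vu-B(u,v)\cdot 1$ and $(uv)w-w(vu)$ with $u,v,w\in V$. Cayley-Dickson process: given an $F$-algebra $A$ with conjugation $a\mapsto a^*$ and $\gamma\in F$, the algebra $A^\gamma$ is the vector space $A^2$ with multiplication $(a,b)\cdot(c,d)=(ac+\gamma d^*b,\ da+bc^* )$ and conjugation $(a,b)^*=(a^*,-b)$.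 Start from $F$ with trivial conjugation $a^*=a$. The octonion algebra over $F$ is $\mathbb{O}=((F^{-1})^{-1})^{-1}$ and the split octonion algebra over $F$ is $\widetilde{\mathbb{O}}=((F^{-1})^{-1})^{1}$. *)

(* Defs.v *)
From HB Require Import structures.
From mathcomp Require Import all_boot all_order all_algebra.
From mathcomp Require Import boolp classical_sets.

Set Implicit Arguments.
Unset Strict Implicit.
Unset Printing Implicit Defensive.

Import GRing.Theory.
Local Open Scope ring_scope.
Local Open Scope classical_set_scope.
Local Open Scope quotient_scope.

(* The multiplication is the one of [umagmaType]; [ring_scope] keeps [+] and
   [*:], so the product and the unit get notations of their own. *)
Declare Scope naalg_scope.
Delimit Scope naalg_scope with A.
Notation "x ** y" := (@monoid.mul _ x%R y%R)
  (at level 40, left associativity) : naalg_scope.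
Notation "\1" := (@monoid.one _) (at level 0) : naalg_scope.
Local Open Scope naalg_scope.

HB.mixin Record Lmodule_UMagma_isNAAlg (F : fieldType) A
    of GRing.Lmodule F A & UMagma A := {
  namul_linearl : forall y : A, linear (fun x : A => x ** y);
  namul_linearr : forall x : A, linear (fun y : A => x ** y)
}.

#[short(type="naAlgType")]
HB.structure Definition NAAlg (F : fieldType) :=
  {A of GRing.Lmodule F A & UMagma A & Lmodule_UMagma_isNAAlg F A}.

Section NAAlgTheory.
Variables (F : fieldType) (A : naAlgType F).
Implicit Types (a : F) (x y z : A).

Lemma namulDl x y z : (x + y) ** z = x ** z + y ** z.
Proof. by have := namul_linearl z 1 x y; rewrite !scale1r. Qed.
Lemma namulDr x y z : x ** (y + z) = x ** y + x ** z.
Proof. by have := namul_linearr x 1 y z; rewrite !scale1r. Qed.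
Lemma namul0r x : 0 ** x = 0.
Proof. by apply: (addrI (0 ** x)); rewrite -namulDl !addr0. Qed.
Lemma namulr0 x : x ** 0 = 0.
Proof. by apply: (addrI (x ** 0)); rewrite -namulDr !addr0. Qed.
Lemma nascaleAl a x y : (a *: x) ** y = a *: (x ** y).
Proof. by have := namul_linearl y a x 0; rewrite namul0r !addr0. Qed.
Lemma nascaleAr a x y : x ** (a *: y) = a *: (x ** y).
Proof. by have := namul_linearr x a y 0; rewrite namulr0 !addr0. Qed.
Lemma namulNr x y : (- x) ** y = - (x ** y).
Proof. by rewrite -scaleN1r nascaleAl scaleN1r. Qed.
Lemma namulrN x y : x ** (- y) = - (x ** y).
Proof. by rewrite -scaleN1r nascaleAr scaleN1r. Qed.
Lemma namulBl x y z : (x - y) ** z = x ** z - y ** z.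
Proof. by rewrite namulDl namulNr. Qed.
Lemma namulBr x y z : x ** (y - z) = x ** y - x ** z.
Proof. by rewrite namulDr namulrN. Qed.

End NAAlgTheory.

Definition alternative (F : fieldType) (A : naAlgType F) : Prop :=
  forall x y : A, x ** (x ** y) = (x ** x) ** y /\
                  y ** (x ** x) = (y ** x) ** x.

Definition alg_morphism (F : fieldType) (A B : naAlgType F) (f : A -> B) :=
  [/\ linear f, f \1 = \1 & {morph f : x y / x ** y}].

Definition alg_isomorphic (F : fieldType) (A B : naAlgType F) : Prop :=
  exists2 f : A -> B, alg_morphism f & bijective f.

Definition two_sided_ideal (F : fieldType) (A : naAlgType F) (I : set A) :=
  [/\ I 0,
      forall (a : F) (x y : A), I x -> I y -> I (a *: x + y) &
      forall x y : A, I x -> I (y ** x) /\ I (x ** y)].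

Definition ideal_gen (F : fieldType) (A : naAlgType F) (S : set A) : set A :=
  smallest (@two_sided_ideal F A) S.

Section Quotient.
Variables (F : fieldType) (A : naAlgType F) (S : set A).

Lemma ideal_genP : two_sided_ideal (ideal_gen S).
Proof.
split=> [I [[]] //|a x y Ix Iy I IS|x y Ix].
  by have [[_ + _] _] := IS; apply; [apply: Ix|apply: Iy].
by split=> I IS; have [[_ _ /(_ x y)[]] //] := IS; apply: Ix.
Qed.

Definition ideal_pred : {pred A} := fun x => `[< ideal_gen S x >].

Lemma ideal_predP : zmod_closed ideal_pred.
Proof.
have [I0 IL _] := ideal_genP.
split=> [|x y /asboolP Ix /asboolP Iy]; apply/asboolP => //.
by rewrite addrC -scaleN1r; apply: IL.
Qed.

HB.instance Definition _ := GRing.isZmodClosed.Build A ideal_pred ideal_predP.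

Definition quot_alg : Type := Quotient.quot ideal_pred.

HB.instance Definition _ := GRing.Zmodule.on quot_alg.
HB.instance Definition _ := EqQuotient.on quot_alg.
HB.instance Definition _ :=
  @isZmodQuotient.Build A (Quotient.equiv ideal_pred) 0 -%R +%R quot_alg
    (@pi_zeror _ _ _ _ _ (Quotient.quot ideal_pred))
    (@pi_oppr _ _ _ _ _ (Quotient.quot ideal_pred))
    (@pi_addr _ _ _ _ _ (Quotient.quot ideal_pred)).

Definition quot_pi (x : A) : quot_alg := \pi_quot_alg x.

Lemma quot_algP (x y : A) :
  (quot_pi x = quot_pi y) <-> ideal_gen S (x - y).
Proof.
split=> [/eqP|Ixy]; first by rewrite /quot_pi piE => /asboolP.
by apply/eqP; rewrite /quot_pi piE; apply/asboolP.
Qed.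

Let qscale a := lift_op1 quot_alg (fun x : A => a *: x).
Let qmul := lift_op2 quot_alg (fun x y : A => x ** y).
Let qone : quot_alg := lift_cst quot_alg \1.

Lemma ideal_gen_repr (x : A) : ideal_gen S (x - repr (quot_pi x)).
Proof. by apply/quot_algP; rewrite /quot_pi reprK. Qed.

Let pi_qscale a : {morph quot_pi : x / a *: x >-> qscale a x}.
Proof.
move=> x; rewrite /qscale; unlock; apply/quot_algP.
have [I0 IL _] := ideal_genP.
by rewrite -scalerBr -[_ *: _]addr0; apply: IL => //; apply: ideal_gen_repr.
Qed.

Let pi_qmul : {morph quot_pi : x y / x ** y >-> qmul x y}.
Proof.
move=> x y; rewrite /qmul; unlock; apply/quot_algP.
have [_ IL IM] := ideal_genP.
rewrite -[x ** y](subrK (x ** repr (quot_pi y))) -addrA.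
rewrite -namulBr -namulBl -[_ ** _]scale1r.
by apply: IL; [apply: (IM _ _ _).1|apply: (IM _ _ _).2];
  apply: ideal_gen_repr.
Qed.

Let pi_qone : quot_pi \1 = qone.
Proof. by rewrite /qone; unlock. Qed.

Let qW (P : quot_alg -> Prop) : (forall x, P (quot_pi x)) -> forall x, P x.
Proof. by move=> PP x; rewrite -[x]reprK; apply: PP. Qed.

Let piD (x y : A) : quot_pi (x + y) = quot_pi x + quot_pi y.
Proof. by rewrite /quot_pi pi_addr. Qed.

Let qscalerA a b v : qscale a (qscale b v) = qscale (a * b) v.
Proof. by elim/qW: v => v; rewrite -!pi_qscale scalerA. Qed.
Let qscale1r : left_id 1 qscale.
Proof. by elim/qW=> v; rewrite -!pi_qscale scale1r. Qed.
Let qscalerDr : right_distributive qscale +%R.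
Proof.
by move=> a; elim/qW=> u; elim/qW=> v; rewrite -!(piD, pi_qscale) scalerDr.
Qed.
Let qscalerDl v : {morph qscale^~ v : a b / a + b}.
Proof.
by elim/qW: v => v a b; rewrite -!pi_qscale -piD scalerDl.
Qed.

HB.instance Definition _ := GRing.Zmodule_isLmodule.Build F quot_alg
  qscalerA qscale1r qscalerDr qscalerDl.

HB.instance Definition _ := hasMul.Build quot_alg qmul.

Let qmul1g : left_id qone qmul.
Proof. by elim/qW=> x; rewrite -pi_qone -pi_qmul mul1g. Qed.
Let qmulg1 : right_id qone qmul.
Proof. by elim/qW=> x; rewrite -pi_qone -pi_qmul mulg1. Qed.

HB.instance Definition _ := Magma_isUMagma.Build quot_alg qmul1g qmulg1.

Lemma pi_scale (a : F) (x : A) : quot_pi (a *: x) = a *: quot_pi x.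
Proof. exact: pi_qscale. Qed.
Lemma pi_mul (x y : A) : quot_pi (x ** y) = quot_pi x ** quot_pi y.
Proof. exact: pi_qmul. Qed.
Lemma pi_one : quot_pi \1 = \1.
Proof. exact: pi_qone. Qed.

Let qmul_linearl (y : quot_alg) : linear (fun x : quot_alg => x ** y).
Proof.
elim/qW: y => y a; elim/qW=> u; elim/qW=> v.
by rewrite -!(pi_scale, pi_mul, piD) namulDl nascaleAl.
Qed.
Let qmul_linearr (x : quot_alg) : linear (fun y : quot_alg => x ** y).
Proof.
elim/qW: x => y a; elim/qW=> u; elim/qW=> v.
by rewrite -!(pi_scale, pi_mul, piD) namulDr nascaleAr.
Qed.

HB.instance Definition _ :=
  Lmodule_UMagma_isNAAlg.Build F quot_alg qmul_linearl qmul_linearr.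

Lemma quot_alg_pi_morphism : alg_morphism quot_pi.
Proof.
split=> [a x y||x y]; last exact: pi_mul; last exact: pi_one.
by rewrite piD pi_scale.
Qed.

End Quotient.

(* [alt V] is the algebra of terms over [V], modulo the least congruence that
   makes it an alternative algebra and [alt_var] a linear map. The theorems
   [alt_var_inj], [alt_one_inj] and [alt_universal] below state the defining
   properties of Alt[V]. *)
Inductive alt_term (F : fieldType) (V : lmodType F) : Type :=
| AVar of V
| AOne
| AAdd of alt_term V & alt_term V
| AScale of F & alt_term V
| AMul of alt_term V & alt_term V.
Arguments AOne {F V}.

(* The zero is [0 *: 1] and the opposite of [x] is [(-1) *: x]. *)
Inductive alt_cong (F : fieldType) (V : lmodType F) :
    alt_term V -> alt_term V -> Prop :=
| ac_refl x : alt_cong x x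
| ac_sym x y : alt_cong x y -> alt_cong y x
| ac_trans x y z : alt_cong x y -> alt_cong y z -> alt_cong x z
| ac_add x x' y y' :
    alt_cong x x' -> alt_cong y y' -> alt_cong (AAdd x y) (AAdd x' y')
| ac_scale a x x' : alt_cong x x' -> alt_cong (AScale a x) (AScale a x')
| ac_mul x x' y y' :
    alt_cong x x' -> alt_cong y y' -> alt_cong (AMul x y) (AMul x' y')
| ac_addA x y z : alt_cong (AAdd x (AAdd y z)) (AAdd (AAdd x y) z)
| ac_addC x y : alt_cong (AAdd x y) (AAdd y x)
| ac_add0 x : alt_cong (AAdd (AScale 0 AOne) x) x
| ac_addN x : alt_cong (AAdd (AScale (-1) x) x) (AScale 0 AOne)
| ac_scaleA a b x : alt_cong (AScale a (AScale b x)) (AScale (a * b) x)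
| ac_scale1 x : alt_cong (AScale 1 x) x
| ac_scaleDr a x y :
    alt_cong (AScale a (AAdd x y)) (AAdd (AScale a x) (AScale a y))
| ac_scaleDl a b x :
    alt_cong (AScale (a + b) x) (AAdd (AScale a x) (AScale b x))
| ac_mul1l x : alt_cong (AMul AOne x) x
| ac_mul1r x : alt_cong (AMul x AOne) x
| ac_mulDl x y z : alt_cong (AMul (AAdd x y) z) (AAdd (AMul x z) (AMul y z))
| ac_mulDr x y z : alt_cong (AMul x (AAdd y z)) (AAdd (AMul x y) (AMul x z))
| ac_mulZl a x y : alt_cong (AMul (AScale a x) y) (AScale a (AMul x y))
| ac_mulZr a x y : alt_cong (AMul x (AScale a y)) (AScale a (AMul x y))
| ac_altl x y : alt_cong (AMul x (AMul x y)) (AMul (AMul x x) y)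
| ac_altr x y : alt_cong (AMul y (AMul x x)) (AMul (AMul y x) x)
| ac_varD u v : alt_cong (AVar (u + v)) (AAdd (AVar u) (AVar v))
| ac_varZ a v : alt_cong (AVar (a *: v)) (AScale a (AVar v)).

Section FreeAlternative.
Variables (F : fieldType) (V : lmodType F).
Local Notation T := (alt_term V).

HB.instance Definition _ := gen_eqMixin T.
HB.instance Definition _ := gen_choiceMixin T.

Definition alt_rel : rel T := fun x y => `[< alt_cong x y >].

Lemma alt_rel_equiv : equiv_class_of alt_rel.
Proof.
split=> [x|x y|y x z]; first exact/asboolP/ac_refl.
  by apply: asbool_equiv_eq; split; apply: ac_sym.
by move=> /asboolP xy /asboolP yz; apply/asboolP/(ac_trans xy).
Qed.

Canonical alt_equiv := EquivRelPack alt_rel_equiv.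
Canonical alt_encModRel := defaultEncModRel alt_rel.

Definition alt : Type := {eq_quot alt_rel}.

HB.instance Definition _ := Choice.on alt.
HB.instance Definition _ := EqQuotient.on alt.

Definition alt_pi (x : T) : alt := \pi_alt x.

Let altP (x y : T) : alt_pi x = alt_pi y <-> alt_cong x y.
Proof.
split=> [/eqP|xy]; first by rewrite /alt_pi piE => /asboolP.
by apply/eqP; rewrite /alt_pi piE; apply/asboolP.
Qed.

Let altP2 (x y : T) : alt_cong x y -> alt_pi x = alt_pi y.
Proof. by move/altP. Qed.

Let alt_repr (x : T) : alt_cong x (repr (alt_pi x)).
Proof. by apply/altP; rewrite /alt_pi reprK. Qed.

Let zero : alt := lift_cst alt (AScale 0 AOne).
Let opp := lift_op1 alt (AScale (-1)).
Let add := lift_op2 alt (@AAdd F V).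
Let scale a := lift_op1 alt (AScale a).
Let mul := lift_op2 alt (@AMul F V).
Let one : alt := lift_cst alt AOne.

Let pi0 : zero = alt_pi (AScale 0 AOne). Proof. by rewrite /zero; unlock. Qed.
Let pi1 : one = alt_pi AOne. Proof. by rewrite /one; unlock. Qed.
Let piN x : opp (alt_pi x) = alt_pi (AScale (-1) x).
Proof. by rewrite /opp; unlock; apply/altP/ac_sym/ac_scale. Qed.
Let piZ a x : scale a (alt_pi x) = alt_pi (AScale a x).
Proof. by rewrite /scale; unlock; apply/altP/ac_sym/ac_scale. Qed.
Let piD x y : add (alt_pi x) (alt_pi y) = alt_pi (AAdd x y).
Proof. by rewrite /add; unlock; apply/altP/ac_sym/ac_add. Qed.
Let piM x y : mul (alt_pi x) (alt_pi y) = alt_pi (AMul x y).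
Proof. by rewrite /mul; unlock; apply/altP/ac_sym/ac_mul. Qed.

Let piW (P : alt -> Prop) : (forall x, P (alt_pi x)) -> forall x, P x.
Proof. by move=> PP x; rewrite -[x]reprK; apply: PP. Qed.

Let addA : associative add.
Proof.
elim/piW=> x; elim/piW=> y; elim/piW=> z; rewrite !piD; exact/altP/ac_addA.
Qed.
Let addC : commutative add.
Proof. elim/piW=> x; elim/piW=> y; rewrite !piD; exact/altP/ac_addC. Qed.
Let add0 : left_id zero add.
Proof. elim/piW=> x; rewrite pi0 piD; exact/altP/ac_add0. Qed.
Let addN : left_inverse zero opp add.
Proof. elim/piW=> x; rewrite pi0 piN piD; exact/altP/ac_addN. Qed.

HB.instance Definition _ := GRing.isZmodule.Build alt addA addC add0 addN.

Lemma alt_piD x y : alt_pi (AAdd x y) = alt_pi x + alt_pi y.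
Proof. by rewrite -piD. Qed.

Let scaleA a b v : scale a (scale b v) = scale (a * b) v.
Proof. elim/piW: v => v; rewrite !piZ; exact/altP/ac_scaleA. Qed.
Let scale1 : left_id 1 scale.
Proof. elim/piW=> v; rewrite piZ; exact/altP/ac_scale1. Qed.
Let scaleDr : right_distributive scale +%R.
Proof.
move=> a; elim/piW=> u; elim/piW=> v; rewrite -alt_piD !piZ -alt_piD.
exact/altP/ac_scaleDr.
Qed.
Let scaleDl v : {morph scale^~ v : a b / a + b}.
Proof.
elim/piW: v => v a b; rewrite !piZ -alt_piD; exact/altP/ac_scaleDl.
Qed.

HB.instance Definition _ :=
  GRing.Zmodule_isLmodule.Build F alt scaleA scale1 scaleDr scaleDl.

HB.instance Definition _ := hasMul.Build alt mul.

Let mul1 : left_id one mul.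
Proof. elim/piW=> x; rewrite pi1 piM; exact/altP/ac_mul1l. Qed.
Let mulx1 : right_id one mul.
Proof. elim/piW=> x; rewrite pi1 piM; exact/altP/ac_mul1r. Qed.

HB.instance Definition _ := Magma_isUMagma.Build alt mul1 mulx1.

Lemma alt_piZ a x : alt_pi (AScale a x) = a *: alt_pi x.
Proof. by rewrite -piZ. Qed.
Lemma alt_piM x y : alt_pi (AMul x y) = alt_pi x ** alt_pi y.
Proof. by rewrite -piM. Qed.
Lemma alt_pi1 : alt_pi AOne = \1.
Proof. by rewrite -pi1. Qed.

Let mul_linearl (y : alt) : linear (fun x : alt => x ** y).
Proof.
elim/piW: y => y a; elim/piW=> u; elim/piW=> v.
rewrite -!(alt_piZ, alt_piM, alt_piD); apply/altP.
by apply: ac_trans (ac_mulDl _ _ _) _; apply: ac_add;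
  [apply: ac_mulZl|apply: ac_refl].
Qed.
Let mul_linearr (x : alt) : linear (fun y : alt => x ** y).
Proof.
elim/piW: x => y a; elim/piW=> u; elim/piW=> v.
rewrite -!(alt_piZ, alt_piM, alt_piD); apply/altP.
by apply: ac_trans (ac_mulDr _ _ _) _; apply: ac_add;
  [apply: ac_mulZr|apply: ac_refl].
Qed.

HB.instance Definition _ :=
  Lmodule_UMagma_isNAAlg.Build F alt mul_linearl mul_linearr.

Definition alt_var (v : V) : alt := alt_pi (AVar v).

Lemma alt_var_linear : linear alt_var.
Proof.
move=> a u v; rewrite /alt_var -alt_piZ -alt_piD; apply/altP.
by apply: ac_trans (ac_varD _ _) _; apply: ac_add;
  [apply: ac_varZ|apply: ac_refl].
Qed.

Theorem alt_alternative : alternative alt.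
Proof.
elim/piW=> x; elim/piW=> y; rewrite -!alt_piM.
by split; apply/altP; [apply: ac_altl|apply: ac_altr].
Qed.

Section Lift.
Variables (A : naAlgType F) (altA : alternative A).
Variables (g : V -> A) (glin : linear g).

Fixpoint alt_eval (t : T) : A :=
  match t with
  | AVar v => g v
  | AOne => \1
  | AAdd x y => alt_eval x + alt_eval y
  | AScale a x => a *: alt_eval x
  | AMul x y => alt_eval x ** alt_eval y
  end.

Lemma alt_eval_cong x y : alt_cong x y -> alt_eval x = alt_eval y.
Proof.
elim=> {x y} //=.
- by move=> x y z _ -> _ ->.
- by move=> x x' y y' _ -> _ ->.
- by move=> a x y _ ->.
- by move=> x x' y y' _ -> _ ->.
- by move=> x y z; rewrite addrA.
- by move=> x y; rewrite addrC.
- by move=> x; rewrite scale0r add0r.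
- by move=> x; rewrite scale0r scaleN1r addNr.
- by move=> a b x; rewrite scalerA.
- by move=> x; rewrite scale1r.
- by move=> a x y; rewrite scalerDr.
- by move=> a b x; rewrite scalerDl.
- by move=> x; rewrite mul1g.
- by move=> x; rewrite mulg1.
- by move=> x y z; rewrite namulDl.
- by move=> x y z; rewrite namulDr.
- by move=> a x y; rewrite nascaleAl.
- by move=> a x y; rewrite nascaleAr.
- by move=> x y; have [] := altA (alt_eval x) (alt_eval y).
- by move=> x y; have [] := altA (alt_eval x) (alt_eval y).
- by move=> u v; have := glin 1 u v; rewrite !scale1r.
- move=> a v; have g0 : g 0 = 0.
    apply: (addrI (g 0)); rewrite addr0.
    by have := glin 1 0 0; rewrite !scale1r addr0 => <-.
  by have := glin a v 0; rewrite g0 !addr0.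
Qed.

Definition alt_lift (x : alt) : A := alt_eval (repr x).

Lemma alt_lift_pi x : alt_lift (alt_pi x) = alt_eval x.
Proof. exact/alt_eval_cong/ac_sym/alt_repr. Qed.

Theorem alt_universal :
  exists! f : alt -> A, alg_morphism f /\ forall v, f (alt_var v) = g v.
Proof.
exists alt_lift; split=> [|f [[flin f1 fM] fg]].
  split=> [|v]; last by rewrite alt_lift_pi.
  split=> [a||]; last first.
  - by elim/piW=> x; elim/piW=> y; rewrite -alt_piM !alt_lift_pi.
  - by rewrite -alt_pi1 alt_lift_pi.
  elim/piW=> x; elim/piW=> y.
  by rewrite -alt_piZ -alt_piD !alt_lift_pi.
have fD x y : f (x + y) = f x + f y.
  by have := flin 1 x y; rewrite !scale1r.
have f0 : f 0 = 0 by apply: (addrI (f 0)); rewrite -fD !addr0.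
have fZ a x : f (a *: x) = a *: f x.
  by have := flin a x 0; rewrite f0 !addr0.
apply/funext; elim/piW=> x; rewrite alt_lift_pi.
elim: x => [v||x IHx y IHy|a x IHx|x IHx y IHy] /=.
- by rewrite fg.
- by rewrite alt_pi1 f1.
- by rewrite alt_piD fD IHx IHy.
- by rewrite alt_piZ fZ IHx.
- by rewrite alt_piM fM IHx IHy.
Qed.

End Lift.

End FreeAlternative.

(* [F] and [V] embed into [alt V]: map it to the algebra F + V with V^2 = 0. *)
Definition null_ext (F : fieldType) (V : lmodType F) : Type := (F^o * V)%type.

Section NullExtension.
Variables (F : fieldType) (V : lmodType F).
Local Notation N := (null_ext V).

HB.instance Definition _ := GRing.Lmodule.copy N (F^o * V)%type.

Let nmul (x y : N) : N := (x.1 * y.1, x.1 *: y.2 + y.1 *: x.2).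
Let none : N := (1, 0).

HB.instance Definition _ := hasMul.Build N nmul.

Let nmul1 : left_id none nmul.
Proof. by case=> a u; rewrite /nmul /= mul1r scale1r scaler0 addr0. Qed.
Let nmulx1 : right_id none nmul.
Proof. by case=> a u; rewrite /nmul /= mulr1 scale1r scaler0 add0r. Qed.

HB.instance Definition _ := Magma_isUMagma.Build N nmul1 nmulx1.

Let nmulC (x y : N) : x ** y = y ** x.
Proof. by congr pair; [rewrite mulrC|rewrite addrC]. Qed.

Let nmul_linearl (y : N) : linear (fun x : N => x ** y).
Proof.
move=> a u v; congr pair; first by rewrite /= mulrDl -scalerAl.
by rewrite /= scalerDl !scalerDr !scalerA [a * y.1]mulrC addrACA.
Qed.
Let nmul_linearr (x : N) : linear (fun y : N => x ** y).
Proof. by move=> a u v; rewrite !(nmulC x) nmul_linearl. Qed.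

HB.instance Definition _ :=
  Lmodule_UMagma_isNAAlg.Build F N nmul_linearl nmul_linearr.

Let nalt : alternative N.
Proof.
suff nA (x y z : N) : x ** (y ** z) = (x ** y) ** z by [].
congr pair; rewrite /= ?mulrA //.
by rewrite !scalerDr !scalerA -addrA [z.1 * _]mulrC [z.1 * _]mulrC.
Qed.

Let nlin : linear (fun v : V => (0, v) : N).
Proof. by move=> a u v; congr pair; rewrite /= scaler0 addr0. Qed.

Theorem alt_var_inj : injective (@alt_var F V).
Proof.
have [f [[_ fg] _]] := alt_universal nalt nlin.
by move=> u v /(congr1 f); rewrite !fg => -[].
Qed.

Theorem alt_one_inj : injective (fun a : F => a *: (\1 : alt V)).
Proof.
have [f [[[fl f1 _] _] _]] := alt_universal nalt nlin.
have fE a : f (a *: \1) = a *: \1 + f 0.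
  by have := fl a \1 0; rewrite addr0 f1.
move=> a b /(congr1 f); rewrite !fE => /addIr /(congr1 fst).
by rewrite -[LHS]/(a * 1) -[RHS]/(b * 1) !mulr1.
Qed.

End NullExtension.

Definition kingdon_relations (F : fieldType) (V : vectType F)
    (B : {symmetric V}) : set (alt V) :=
  [set x | (exists u v : V,
              x = alt_var u ** alt_var v + alt_var v ** alt_var u
                  - B u v *: \1) \/
           (exists u v w : V,
              x = (alt_var u ** alt_var v) ** alt_var w
                  - alt_var w ** (alt_var v ** alt_var u))].

Definition kingdon (F : fieldType) (V : vectType F) (B : {symmetric V}) :
    naAlgType F :=
  quot_alg (kingdon_relations B).

HB.mixin Record NAAlg_hasConj (F : fieldType) A of NAAlg F A := {
  naconj : A -> A;
  naconj_linear : linear naconj;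
  naconjK : involutive naconj;
  naconjM : forall x y : A, naconj (x ** y) = naconj y ** naconj x
}.

#[short(type="conjAlgType")]
HB.structure Definition ConjAlg (F : fieldType) :=
  {A of NAAlg F A & NAAlg_hasConj F A}.

Section ConjAlgTheory.
Variables (F : fieldType) (A : conjAlgType F).
Implicit Types (a : F) (x y : A).

Lemma naconjD x y : naconj (x + y) = naconj x + naconj y.
Proof. by have := naconj_linear 1 x y; rewrite !scale1r. Qed.
Lemma naconj0 : naconj (0 : A) = 0.
Proof. by apply: (addrI (naconj (0 : A))); rewrite -naconjD !addr0. Qed.
Lemma naconjZ a x : naconj (a *: x) = a *: naconj x.
Proof. by have := naconj_linear a x 0; rewrite naconj0 !addr0. Qed.
Lemma naconjN x : naconj (- x) = - naconj x.
Proof. by rewrite -scaleN1r naconjZ scaleN1r. Qed.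
Lemma naconj1 : naconj (\1 : A) = \1.
Proof. by rewrite -[LHS]mulg1 -{2}[\1]naconjK -naconjM mulg1 naconjK. Qed.

End ConjAlgTheory.

Definition scalar_alg (F : fieldType) : Type := F^o.

Section ScalarAlg.
Variable F : fieldType.
Local Notation S := (scalar_alg F).

HB.instance Definition _ := GRing.Lmodule.copy S F^o.
HB.instance Definition _ := hasMul.Build S (fun x y : F => x * y).
HB.instance Definition _ := Magma_isUMagma.Build S (@mul1r F) (@mulr1 F).

Let smul_linearl (y : S) : linear (fun x : S => x ** y).
Proof. by move=> a u v; rewrite -[LHS]/((a * u + v) * y) mulrDl -mulrA. Qed.
Let smul_linearr (x : S) : linear (fun y : S => x ** y).
Proof. by move=> a u v; rewrite -[LHS]/(x * (a * u + v)) mulrDr mulrCA. Qed.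

HB.instance Definition _ :=
  Lmodule_UMagma_isNAAlg.Build F S smul_linearl smul_linearr.

Let sid_linear : linear (id : S -> S). Proof. by []. Qed.
Let sidK : involutive (id : S -> S). Proof. by []. Qed.
Let sidM (x y : S) : id (x ** y) = id y ** id x.
Proof. exact: mulrC. Qed.

HB.instance Definition _ := NAAlg_hasConj.Build F S sid_linear sidK sidM.

End ScalarAlg.

Definition cayley_dickson (F : fieldType) (A : conjAlgType F) (gamma : F) :
  Type := (A * A)%type.

Section CayleyDickson.
Variables (F : fieldType) (A : conjAlgType F) (gamma : F).
Local Notation D := (cayley_dickson A gamma).

HB.instance Definition _ := GRing.Lmodule.copy D (A * A)%type.

Definition cd_mul (x y : D) : D :=
  let: (a, b) := x in let: (c, d) := y in
  (a ** c + gamma *: (naconj d ** b), d ** a + b ** naconj c).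
Definition cd_one : D := (\1, 0).
Definition cd_conj (x : D) : D := let: (a, b) := x in (naconj a, - b).

HB.instance Definition _ := hasMul.Build D cd_mul.

Let cd_mul1 : left_id cd_one cd_mul.
Proof.
by case=> c d; rewrite /= mul1g mulg1 namul0r namulr0 scaler0 !addr0.
Qed.
Let cd_mulx1 : right_id cd_one cd_mul.
Proof.
by case=> a b; rewrite /= naconj0 naconj1 !mulg1 !namul0r scaler0 addr0 add0r.
Qed.

HB.instance Definition _ := Magma_isUMagma.Build D cd_mul1 cd_mulx1.

Let cd_mul_linearl (y : D) : linear (fun x : D => x ** y).
Proof.
case: y => c d k [a b] [a' b']; congr pair; rewrite /=.
  rewrite namulDl namulDr nascaleAl nascaleAr !scalerDr !scalerA.
  by rewrite [gamma * k]mulrC addrACA.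
by rewrite namulDl namulDr nascaleAl nascaleAr scalerDr addrACA.
Qed.
Let cd_mul_linearr (x : D) : linear (fun y : D => x ** y).
Proof.
case: x => a b k [c d] [c' d']; congr pair; rewrite /= !(naconjD, naconjZ).
  rewrite namulDl namulDr nascaleAl nascaleAr !scalerDr !scalerA.
  by rewrite [gamma * k]mulrC addrACA.
by rewrite namulDl namulDr nascaleAl nascaleAr scalerDr addrACA.
Qed.

HB.instance Definition _ :=
  Lmodule_UMagma_isNAAlg.Build F D cd_mul_linearl cd_mul_linearr.

Let cd_conj_linear : linear cd_conj.
Proof.
move=> k [a b] [a' b']; congr pair; rewrite /= ?naconjD ?naconjZ //.
by rewrite opprD scalerN.
Qed.
Let cd_conjK : involutive cd_conj.
Proof. by case=> a b; rewrite /= naconjK opprK. Qed.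
Let cd_conjM (x y : D) : cd_conj (x ** y) = cd_conj y ** cd_conj x.
Proof.
case: x y => [a b] [c d]; congr pair; rewrite /=.
  by rewrite naconjD naconjZ !naconjM naconjK naconjN namulNr namulrN opprK.
by rewrite naconjK !namulNr opprD addrC.
Qed.

HB.instance Definition _ :=
  NAAlg_hasConj.Build F D cd_conj_linear cd_conjK cd_conjM.

End CayleyDickson.

Definition octonion (F : fieldType) : naAlgType F :=
  cayley_dickson (cayley_dickson (cayley_dickson (scalar_alg F) (-1)) (-1)) (-1).

Definition split_octonion (F : fieldType) : naAlgType F :=
  cayley_dickson (cayley_dickson (cayley_dickson (scalar_alg F) (-1)) (-1)) 1.

(* Main.v *)
From HB Require Import structures.
Require Import Defs.
From mathcomp Require Import all_boot all_order all_algebra.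
From mathcomp Require Import ring.
From mathcomp Require Import boolp classical_sets.

(* Let [i], [j], [k] also denote the images of the basis in the Kingdon algebra
   [K], alternative, in which they anticommute and have scalar squares.
   If a subalgebra [A] of an alternative algebra has a conjugation with scalar
   traces, and [l] satisfies [l a = a^* l] on [A] and has a scalar square
   [gamma], then [a + b l] multiplies as in the Cayley-Dickson double [A^gamma].
   Adjoining [i], [j], [k] in turn gives a morphism to [K] from the triple
   double of [F]; the last step needs [k (i j) = (j i) k], an instance of the
   second family of relations of [K]. Conversely the triple double is
   alternative and satisfies both families, which gives a morphism from [K];
   the two morphisms are inverse to each other on generators. *)

Set Implicit Arguments.
Unset Strict Implicit.
Unset Printing Implicit Defensive.

Import GRing.Theory.
Local Open Scope ring_scope.
Local Open Scope naalg_scope.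

(** * Morphisms and quotients of nonassociative algebras *)

Section AlgMorphism.
Variables (F : fieldType) (A B : naAlgType F) (f : A -> B).
Hypothesis f_morph : alg_morphism f.

Lemma alg_morphismD : {morph f : x y / x + y}.
Proof. by case: f_morph => fL _ _ x y; have := fL 1 x y; rewrite !scale1r. Qed.

Lemma alg_morphism0 : f 0 = 0.
Proof. by apply: (addrI (f 0)); rewrite -alg_morphismD !addr0. Qed.

Lemma alg_morphismZ a : {morph f : x / a *: x}.
Proof.
by case: f_morph => fL _ _ x; have := fL a x 0; rewrite alg_morphism0 !addr0.
Qed.

Lemma alg_morphismB : {morph f : x y / x - y}.
Proof.
by move=> x y; rewrite -!scaleN1r alg_morphismD alg_morphismZ.
Qed.

Lemma alg_morphism_alternative :
  (forall y, exists x, f x = y) -> alternative A -> alternative B.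
Proof.
case: f_morph => _ _ fM f_surj altA x y.
have [[{}x <-] [{}y <-]] := (f_surj x, f_surj y).
by have [altl altr] := altA x y; rewrite -!fM altl altr.
Qed.

End AlgMorphism.

Lemma alg_morphism_comp (F : fieldType) (A B C : naAlgType F)
    (g : B -> C) (f : A -> B) :
  alg_morphism g -> alg_morphism f -> alg_morphism (g \o f).
Proof.
move=> [gL g1 gM] [fL f1 fM]; split=> [a x y||x y] /=.
- by rewrite fL gL.
- by rewrite f1.
- by rewrite fM gM.
Qed.

Lemma alg_morphism_kernel (F : fieldType) (A B : naAlgType F) (f : A -> B) :
  alg_morphism f -> two_sided_ideal [set x | f x = 0]%classic.
Proof.
move=> f_morph; have [fL _ fM] := f_morph; split=> [|a x y /= x0 y0|x y /= x0].
- exact: alg_morphism0.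
- by rewrite fL x0 y0 scaler0 addr0.
- by rewrite !fM x0 namul0r namulr0.
Qed.

Section QuotientAlgebra.
Variables (F : fieldType) (A : naAlgType F) (S : set A).

Lemma quot_pi_surj (y : quot_alg S) : exists x, quot_pi S x = y.
Proof. by exists (repr y); rewrite /quot_pi reprK. Qed.

Lemma quot_pi_eq (x y : A) : S (x - y) -> quot_pi S x = quot_pi S y.
Proof. by move=> Sxy; apply/quot_algP; apply: sub_gen_smallest. Qed.

Lemma quot_alg_alternative : alternative A -> alternative (quot_alg S).
Proof.
exact: alg_morphism_alternative (quot_alg_pi_morphism S) quot_pi_surj.
Qed.

(** The kernel of [h] is a two-sided ideal containing [S], hence contains the ideal generated by
    [S]. So [h] is constant on classes and may be evaluated at representatives. *)
Lemma quot_alg_lift (B : naAlgType F) (h : A -> B) :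
  alg_morphism h -> (forall x, S x -> h x = 0) ->
  exists2 f : quot_alg S -> B, alg_morphism f & forall x, f (quot_pi S x) = h x.
Proof.
move=> h_morph hS; have [hL h1 hM] := h_morph.
have h_eq x y : quot_pi S x = quot_pi S y -> h x = h y.
  move/quot_algP => Ixy; apply/eqP; rewrite -subr_eq0 -(alg_morphismB h_morph).
  apply/eqP.
  have kerP := alg_morphism_kernel h_morph.
  exact: (Ixy [set z | h z = 0]%classic (conj kerP hS)).
pose f (y : quot_alg S) := h (repr y); have fE x : f (quot_pi S x) = h x.
  by apply: h_eq; rewrite /quot_pi reprK.
have [piL pi1 piM] := quot_alg_pi_morphism S.
exists f => //; split=> [a y z||y z].
- have [[x <-] [x' <-]] := (quot_pi_surj y, quot_pi_surj z).
  by rewrite -piL !fE hL.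
- by rewrite -pi1 fE h1.
- have [[x <-] [x' <-]] := (quot_pi_surj y, quot_pi_surj z).
  by rewrite -piM !fE hM.
Qed.

End QuotientAlgebra.

(** * Extending a morphism to a Cayley-Dickson double *)

Section CayleyDicksonExtension.
Variables (F : fieldType) (A : conjAlgType F) (K : naAlgType F).
Variables (psi : A -> K) (l : K) (gamma : F).

Definition cd_ext (x : cayley_dickson A gamma) : K := psi x.1 + psi x.2 ** l.

Hypotheses (altK : alternative K) (psi_morph : alg_morphism psi).
Hypothesis traceA : forall a : A, exists t : F, a + naconj a = t *: \1.
Hypothesis sqr_l : l ** l = gamma *: \1.
Hypothesis comm_l : forall a, l ** psi a = psi (naconj a) ** l.

(** Linearization of the left alternative law: expand it at [x + y] and cancel the terms quadratic
    in [x] or in [y]. *)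
Let alt_left (x y z : K) :
  x ** (y ** z) + y ** (x ** z) = (x ** y + y ** x) ** z.
Proof.
rewrite namulDl; have := (altK (x + y) z).1.
rewrite !(namulDl, namulDr) -!(altK _ _).1.
by rewrite -!addrA => /addrI; rewrite !addrA => /addIr ->; rewrite addrC.
Qed.

Let alt_right (x y z : K) :
  (z ** x) ** y + (z ** y) ** x = z ** (x ** y + y ** x).
Proof.
rewrite [RHS]namulDr; have := (altK (x + y) z).2.
rewrite !(namulDl, namulDr) -!(altK _ _).2.
rewrite -!addrA => /addrI; rewrite !addrA => /addIr E.
by rewrite addrC -E addrC.
Qed.

Let conjE a t : a + naconj a = t *: \1 -> psi (naconj a) = t *: \1 - psi a.
Proof.
have [_ psi1 _] := psi_morph; rewrite -psi1 -(alg_morphismZ psi_morph) => <-.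
by rewrite (alg_morphismD psi_morph) addrC addKr.
Qed.

(** Linearized alternativity only evaluates sums of two products. Since a^* = t - a with t scalar,
    the hypothesis on [l] gives l a + a l = t l, and the unwanted summand can be cancelled in each
    of the products (a l) d, a (d l) and (b l)(d l). *)
Lemma cd_ext_morphism : alg_morphism cd_ext.
Proof.
have [psiL psi1 psiM] := psi_morph.
have traceK a : exists2 t : F, psi (naconj a) = t *: \1 - psi a
    & l ** psi a = t *: l - psi a ** l.
  have [t /conjE tE] := traceA a; exists t => //.
  by rewrite comm_l tE namulBl nascaleAl mul1g.
have mul_r a d : (psi a ** l) ** psi d = psi (a ** naconj d) ** l.
  have [t cE lE] := traceK d; rewrite psiM cE namulBr namulBl nascaleAr mulg1.
  (* After adding (a d) l, both sides equal t (a l). *)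
  apply: (addIr ((psi a ** psi d) ** l)); rewrite alt_right lE.
  by rewrite !subrK nascaleAr nascaleAl.
have mul_l a d : psi a ** (psi d ** l) = psi (d ** a) ** l.
  have [t cE lE] := traceK a.
  have dlE : psi d ** l = l ** psi (naconj d) by rewrite comm_l naconjK.
  apply: (addIr (l ** (psi a ** psi (naconj d)))); rewrite dlE alt_left lE.
  rewrite addrC subrK nascaleAl -dlE -psiM comm_l naconjM naconjK -namulDl.
  by rewrite !psiM -namulDr cE addrC subrK nascaleAr mulg1 nascaleAl.
have mul_ll b d : (psi b ** l) ** (psi d ** l) = gamma *: psi (naconj d ** b).
  have [t cE lE] := traceK d.
  have dl_l : (psi d ** l) ** l = gamma *: psi d.
    by rewrite -(altK _ _).2 sqr_l nascaleAr mulg1.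
  have l_dl : l ** (psi d ** l) = gamma *: psi (naconj d).
    by rewrite -[d in LHS]naconjK -comm_l (altK _ _).1 sqr_l nascaleAl mul1g.
  have db_ll : (psi (d ** b) ** l) ** l = gamma *: psi (d ** b).
    by rewrite -(altK _ _).2 sqr_l nascaleAr mulg1.
  (* (b l)(d l) + (b (d l)) l = b (l (d l) + (d l) l) = gamma b (d^* + d) *)
  apply: (addIr (gamma *: psi (d ** b))).
  rewrite -[in LHS]db_ll -mul_l alt_right dl_l l_dl -!scalerDr nascaleAr cE.
  by rewrite subrK !psiM cE -namulDl subrK nascaleAr nascaleAl mul1g mulg1.
split=> [a [x y] [x' y']||[a b] [c d]]; rewrite /cd_ext /=.
- by rewrite !psiL namulDl nascaleAl scalerDr addrACA.
- by rewrite psi1 (alg_morphism0 psi_morph) namul0r addr0.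
rewrite !(alg_morphismD psi_morph) (alg_morphismZ psi_morph).
by rewrite !namulDl !namulDr mul_r mul_l mul_ll psiM [LHS]addrAC !addrA.
Qed.

End CayleyDicksonExtension.

Section CayleyDicksonInclusion.
Variables (F : fieldType) (A : conjAlgType F) (gamma : F).
Local Notation D := (cayley_dickson A gamma).

Definition cd_inl (a : A) : D := (a, 0).
Definition cd_unit : D := (0, \1).

Lemma cd_inl_morphism : alg_morphism cd_inl.
Proof.
split=> [t a b||a b] //; congr pair; rewrite /= ?scaler0 ?addr0 //.
  by rewrite naconj0 namul0r scaler0 addr0.
by rewrite !namul0r addr0.
Qed.

Lemma cd_decomp x : cd_inl x.1 + cd_inl x.2 ** cd_unit = x.
Proof.
case: x => a b; congr pair; rewrite /=.
  by rewrite !namulr0 scaler0 !addr0.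
by rewrite naconj0 namulr0 mul1g addr0 add0r.
Qed.

(** A morphism on the double is determined by its restriction to [A] and its value at [cd_unit]. *)
Lemma cd_ext_comp (K K' : naAlgType F) (psi : A -> K) (l : K)
    (theta : K -> K') (tau : D -> K') :
  alg_morphism theta -> alg_morphism tau ->
  theta \o psi =1 tau \o cd_inl -> theta l = tau cd_unit ->
  theta \o @cd_ext F A K psi l gamma =1 tau.
Proof.
move=> theta_morph tau_morph psiE lE x; rewrite /cd_ext /=.
have [[_ _ thetaM] [_ _ tauM]] := (theta_morph, tau_morph).
rewrite (alg_morphismD theta_morph) thetaM lE.
move: (psiE x.1) (psiE x.2) => /= -> ->.
by rewrite -tauM -(alg_morphismD tau_morph) cd_decomp.
Qed.

End CayleyDicksonInclusion.

Section CayleyDicksonTrace.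
Variables (F : fieldType) (A : conjAlgType F) (gamma : F).

(** Conjugation negates the second component, so the trace of a pair is that of its first
    component. *)
Lemma cayley_dickson_trace :
  (forall a : A, exists t : F, a + naconj a = t *: \1) ->
  forall x : cayley_dickson A gamma, exists t : F, x + naconj x = t *: \1.
Proof.
move=> traceA [a b]; have [t tE] := traceA a; exists t.
by congr pair; rewrite /= ?tE // subrr scaler0.
Qed.

End CayleyDicksonTrace.

Section ScalarAlgebra.
Variable F : fieldType.

Lemma scalar_trace (b : scalar_alg F) : exists t : F, b + naconj b = t *: \1.
Proof. by exists ((b : F) + b); rewrite -[RHS]/(_ * 1 : F) mulr1. Qed.

Lemma scalar_unit_morphism (K : naAlgType F) :
  alg_morphism (fun b : scalar_alg F => (b : F) *: (\1 : K)).
Proof.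
split=> [a b c||b c]; first by rewrite scalerDl scalerA.
  by rewrite scale1r.
by rewrite nascaleAl mul1g scalerA.
Qed.

End ScalarAlgebra.

(* Unfolding is used because rewriting with the defining equations of
   [scalar_alg], whose sides are convertible, is much slower. *)
Ltac scalar_ring :=
  rewrite /= /GRing.scale /monoid.mul /monoid.one /naconj /=; ring.

(** * Polynomial identities in the triple double of the field *)

Section IteratedCayleyDickson.
Variables (F : fieldType) (alpha beta gamma : F).
Local Notation C := (cayley_dickson (scalar_alg F) alpha).
Local Notation H := (cayley_dickson C beta).
Local Notation O := (cayley_dickson H gamma).

Lemma cayley_dickson3_alternative : alternative O.
Proof.
move=> [[[x0 x1] [x2 x3]] [[x4 x5] [x6 x7]]].
move=> [[[y0 y1] [y2 y3]] [[y4 y5] [y6 y7]]].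
by split; congr (((_, _), (_, _)), ((_, _), (_, _))); scalar_ring.
Qed.

(** The element a i + b j + c k, where i, j, k are the units adjoined by the three successive
    doublings; these span the image of [V]. *)
Definition cd_imag (a b c : F) : O := (((0, a), (b, 0)), ((c, 0), (0, 0))).

Lemma cd_imag_anticomm a b c a' b' c' :
  let u := cd_imag a b c in let v := cd_imag a' b' c' in
  u ** v + v ** u =
  (2 * (alpha * a * a' + beta * b * b' + gamma * c * c')) *: \1.
Proof.
by congr (((_, _), (_, _)), ((_, _), (_, _))); scalar_ring.
Qed.

(** Conjugation reverses products and negates u, v, w, so the identity says that (u v) w has trace
    zero: u v lies in the span of 1, i j, i k, j k, which is orthogonal to i, j, k. The proof
    compares coordinates. *)
Lemma cd_imag_reverse a b c a' b' c' a'' b'' c'' :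
  let u := cd_imag a b c in let v := cd_imag a' b' c' in
  let w := cd_imag a'' b'' c'' in (u ** v) ** w = w ** (v ** u).
Proof.
by congr (((_, _), (_, _)), ((_, _), (_, _))); scalar_ring.
Qed.

End IteratedCayleyDickson.

(** * Relations and universal property of the Kingdon algebra *)

Section Kingdon.
Variables (F : fieldType) (V : vectType F) (B : {symmetric V}).

Definition kingdon_var (v : V) : kingdon B :=
  quot_pi (kingdon_relations B) (alt_var v).

Let pi_morph : @alg_morphism F (alt V) (kingdon B) (quot_pi _) :=
  quot_alg_pi_morphism (kingdon_relations B).
Let piM : {morph quot_pi _ : x y / x ** y >-> (x ** y : kingdon B)}.
Proof. by case: pi_morph. Qed.
Let pi1 : quot_pi _ \1 = \1 :> kingdon B.
Proof. by case: pi_morph. Qed.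
Let quot_piE :=
  (alg_morphismD pi_morph, alg_morphismZ pi_morph, piM, pi1).

Lemma kingdon_var_linear : linear kingdon_var.
Proof. by move=> a u v; rewrite /kingdon_var alt_var_linear !quot_piE. Qed.

HB.instance Definition _ :=
  GRing.isLinear.Build F V (kingdon B) *:%R kingdon_var kingdon_var_linear.

Lemma kingdon_anticomm u v :
  kingdon_var u ** kingdon_var v + kingdon_var v ** kingdon_var u
  = B u v *: \1.
Proof.
by rewrite /kingdon_var -!quot_piE; apply: quot_pi_eq; left; exists u, v.
Qed.

Lemma kingdon_reverse u v w :
  (kingdon_var u ** kingdon_var v) ** kingdon_var w
  = kingdon_var w ** (kingdon_var v ** kingdon_var u).
Proof.
by rewrite /kingdon_var -!quot_piE; apply: quot_pi_eq; right; exists u, v, w.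
Qed.

Lemma kingdon_alternative : alternative (kingdon B).
Proof. exact: quot_alg_alternative (@alt_alternative F V). Qed.

Lemma kingdon_lift (A : naAlgType F) (g : V -> A) :
  alternative A -> linear g ->
  (forall u v, g u ** g v + g v ** g u = B u v *: \1) ->
  (forall u v w, (g u ** g v) ** g w = g w ** (g v ** g u)) ->
  exists2 f : kingdon B -> A,
    alg_morphism f & forall v, f (kingdon_var v) = g v.
Proof.
move=> altA glin g_anti g_rev.
have [h [[h_morph hg] _]] := alt_universal altA glin; have [_ h1 hM] := h_morph.
have [|f f_morph fh] := quot_alg_lift (S := kingdon_relations B) h_morph.
  move=> x [[u [v ->]]|[u [v [w ->]]]]; rewrite (alg_morphismB h_morph).
    rewrite (alg_morphismD h_morph) (alg_morphismZ h_morph) !hM h1 !hg.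
    by rewrite g_anti subrr.
  by rewrite !hM !hg g_rev subrr.
by exists f => // v; rewrite fh hg.
Qed.

(** Composed with the projection, both maps extend the same linear map to [alt V], where extensions
    are unique. *)
Lemma kingdon_morphism_eq (A : naAlgType F) (f f' : kingdon B -> A) :
  alternative A -> alg_morphism f -> alg_morphism f' ->
  (forall v, f (kingdon_var v) = f' (kingdon_var v)) -> f =1 f'.
Proof.
move=> altA f_morph f'_morph ff' x.
have fpi_morph := alg_morphism_comp f_morph pi_morph.
have f'pi_morph := alg_morphism_comp f'_morph pi_morph.
have glin : linear (fun v => f (kingdon_var v)).
  by move=> a u v; rewrite kingdon_var_linear; case: f_morph => ->.
have [h [_ h_uniq]] := alt_universal altA glin.
have [y <-] := quot_pi_surj x.
have fE : h = f \o quot_pi _ by apply: h_uniq.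
have f'E : h = f' \o quot_pi _ by apply: h_uniq; split=> // v; rewrite ff'.
by have := congr1 (@^~ y) (etrans (esym fE) f'E).
Qed.

(** Anticommutation of [v] with itself gives 2 v^2 = B(v, v), and 2 is invertible. *)
Lemma kingdon_sqr v (b : F) : 2%N \notin [pchar F] -> B v v = 2 * b ->
  kingdon_var v ** kingdon_var v = b *: \1.
Proof.
move=> char2 Bv; have n2 : (2 : F) != 0 by move: char2; rewrite inE.
apply: (scalerI n2); rewrite scalerA -Bv -kingdon_anticomm.
by rewrite -[2]/(1 + 1) scalerDl scale1r.
Qed.

Lemma kingdon_orth u v : B u v = 0 ->
  kingdon_var u ** kingdon_var v = - (kingdon_var v ** kingdon_var u).
Proof.
by move=> uv0; apply/eqP; rewrite -addr_eq0 kingdon_anticomm uv0 scale0r.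
Qed.

End Kingdon.

(** * The isomorphism for arbitrary doubling parameters *)

Lemma kingdon_isomorphic (F : fieldType) (V : vectType F) (i j k : V)
    (B : {symmetric V}) (alpha beta gamma : F) :
  2%N \notin [pchar F] -> basis_of {:V} [:: i; j; k] ->
  B i j = 0 -> B i k = 0 -> B j k = 0 ->
  B i i = 2 * alpha -> B j j = 2 * beta -> B k k = 2 * gamma ->
  alg_isomorphic (kingdon B)
    (cayley_dickson (cayley_dickson (cayley_dickson
       (scalar_alg F) alpha) beta) gamma).
Proof.
move=> char2 ijk_basis Bij Bik Bjk Bii Bjj Bkk.
have Bsym u v : B u v = B v u by rewrite hermC expr0 mul1r.
have altK := @kingdon_alternative F V B.
have altO := @cayley_dickson3_alternative F alpha beta gamma.
set O := cayley_dickson _ gamma in altO *.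
have K_orth := @kingdon_orth F V B.
pose I := kingdon_var B i; pose J := kingdon_var B j; pose L := kingdon_var B k.
have trC := cayley_dickson_trace (gamma := alpha) (@scalar_trace F).
have trH := cayley_dickson_trace (gamma := beta) trC.
(* The tower of maps into the Kingdon algebra: scalars first, then [i], [j], [k] adjoined in
   turn. *)
pose psiF (b : scalar_alg F) : kingdon B := (b : F) *: \1.
pose psiC : _ -> kingdon B := @cd_ext F (scalar_alg F) _ psiF I alpha.
pose psiH : _ -> kingdon B := @cd_ext F _ _ psiC J beta.
pose phi : O -> kingdon B := @cd_ext F _ _ psiH L gamma.
have psiF_morph : alg_morphism psiF := scalar_unit_morphism (kingdon B).
have psiC_morph : alg_morphism psiC.
  apply: cd_ext_morphism => //; [exact: scalar_trace | exact: kingdon_sqr |].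
  by move=> b; rewrite nascaleAr nascaleAl mulg1 mul1g.
have psiH_morph : alg_morphism psiH.
  apply: cd_ext_morphism => //; [exact: kingdon_sqr |].
  move=> [a b]; rewrite /psiC /cd_ext /psiF /=.
  rewrite !(namulDr, namulDl, nascaleAl, nascaleAr, mulg1, mul1g, scaleNr).
  by rewrite -/I -/J (K_orth j i) 1?Bsym // !(namulNr, scalerN).
have phi_morph : alg_morphism phi.
  apply: cd_ext_morphism => //; [exact: kingdon_sqr |].
  move=> [[a b] [c d]]; rewrite /psiH /psiC /cd_ext /psiF /=.
  rewrite !(namulDr, namulDl, nascaleAl, nascaleAr, mulg1, mul1g, scaleNr).
  rewrite -/I -/J -/L (K_orth k i) 1?Bsym // (K_orth k j) 1?Bsym //.
  (* The i j term needs more than anticommutation: k (i j) = (j i) k = - (i j) k. *)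
  rewrite -kingdon_reverse (K_orth i j) // !namulNr.
  by rewrite !(scalerN, opprK).
pose X := [tuple i; j; k].
pose ci := coord X ord0; pose cj := coord X (lift ord0 ord0).
pose ck := coord X (lift ord0 (lift ord0 ord0)).
have ijk_span v : v = ci v *: i + cj v *: j + ck v *: k.
  rewrite {1}(coord_basis (ijk_basis : basis_of _ X) (memvf v)).
  by rewrite !big_ord_recl big_ord0 addr0 addrA.
pose g v : O := cd_imag alpha beta gamma (ci v) (cj v) (ck v).
have glin : linear g.
  move=> a u v; rewrite /g /ci /cj /ck !linearP.
  by congr (((_, _), (_, _)), ((_, _), (_, _))); rewrite /= ?scaler0 ?addr0.
have [||f f_morph fg] := kingdon_lift altO glin (B := B).
- move=> u v; rewrite cd_imag_anticomm; congr (_ *: _).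
  (* In an orthogonal basis, [B] is the diagonal form with entries twice the parameters. *)
  rewrite [in RHS](ijk_span u) [in RHS](ijk_span v).
  rewrite !(linearDl, linearDr, linearZl_LR, linearZr_LR) /=.
  rewrite (Bsym j i) (Bsym k i) (Bsym k j) Bij Bik Bjk Bii Bjj Bkk.
  by rewrite /GRing.scale /=; ring.
- by move=> u v w; apply: cd_imag_reverse.
have free_ijk : free X := basis_free ijk_basis.
have gE (n : 'I_3) :
    g X`_n = cd_imag alpha beta gamma (n == ord0)%:R (n == lift ord0 ord0)%:R
      (n == lift ord0 (lift ord0 ord0))%:R.
  by rewrite /g /ci /cj /ck !coord_free.
have gi : g i = cd_imag alpha beta gamma 1 0 0 := gE ord0.
have gj : g j = cd_imag alpha beta gamma 0 1 0 := gE (lift ord0 ord0).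
have gk : g k = cd_imag alpha beta gamma 0 0 1 :=
  gE (lift ord0 (lift ord0 ord0)).
have [fL f1 fM] := f_morph.
pose inlC := @cd_inl F (cayley_dickson (scalar_alg F) alpha) beta.
pose inlH := @cd_inl F
  (cayley_dickson (cayley_dickson (scalar_alg F) alpha) beta) gamma.
have inlC_morph : alg_morphism inlC := cd_inl_morphism _ _.
have inlH_morph : alg_morphism inlH := cd_inl_morphism _ _.
exists f => //; exists phi => [x|x].
  (* [phi \o f] is an endomorphism fixing the image of [V], hence the identity. *)
  have phif_morph := alg_morphism_comp phi_morph f_morph.
  apply: (kingdon_morphism_eq altK phif_morph) => [|v] /=; first by split.
  rewrite fg [in RHS](ijk_span v) !linearD !linearZ /=.
  rewrite /g /phi /cd_ext /psiH /cd_ext /psiC /cd_ext /psiF /=.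
  rewrite !scale0r !(namulDl, namul0r, add0r, addr0, nascaleAl, mul1g).
  by [].
(* The other composite is computed up the tower: at each level [f] undoes the map into the Kingdon
   algebra, up to the inclusion into [O]. *)
have fC : f \o psiC =1 inlH \o inlC.
  apply: (cd_ext_comp f_morph (alg_morphism_comp inlH_morph inlC_morph)).
    move=> b; rewrite /= /psiF (alg_morphismZ f_morph) f1.
    by congr (((_, _), (_, _)), ((_, _), (_, _))); scalar_ring.
  by rewrite fg gi.
have fH : f \o psiH =1 inlH.
  by apply: (cd_ext_comp f_morph inlH_morph fC); rewrite fg gj.
have idO_morph : @alg_morphism F O O id by [].
by apply: (cd_ext_comp f_morph idO_morph fH); rewrite fg gk.
Qed.

Theorem theorem3p14 (F : fieldType) (V : vectType F) (i j k : V)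
    (B : {symmetric V})
    (char_neq2 : 2%N \notin [pchar F])
    (dimV : \dim {:V} = 3%N)
    (spanV : <<[:: i; j; k]>>%VS = {:V}%VS)
    (orth_ij : B i j = 0) (orth_ik : B i k = 0) (orth_jk : B j k = 0) :
  (B i i = -2 -> B j j = -2 -> B k k = -2 ->
     alg_isomorphic (kingdon B) (octonion F)) /\
  (B i i = -2 -> B j j = -2 -> B k k = 2 ->
     alg_isomorphic (kingdon B) (split_octonion F)).
Proof.
have ijk_basis : basis_of {:V} [:: i; j; k].
  by rewrite basisEdim spanV dimV subvv.
(* The parameters are half the values of [B]: -1, -1, -1 for (a) and -1, -1, 1 for (b). *)
by split=> Bii Bjj Bkk; apply: (kingdon_isomorphic char_neq2 ijk_basis);
  rewrite ?mulr1 ?mulrN1.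
Qed.
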